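(* Let $m<\infty$, let $D$ be any finite data list in $\Gamma$, and let $z$ be a binary string of length $\ell(z)\le m$. If $\ell(z)<m$, the evidence satisfies the recursion $$p_z(D_z)\;=\;u\;+\;s\cdot\frac{p_{z0}(D_{z0})\,p_{z1}(D_{z1})}{w(n_{z0},n_{z1})},$$ where $$w(n_{z0},n_{z1})\;:=\;2^{-n_z}\,\frac{\Gamma(n_z+2\alpha)}{\Gamma(n_{z0}+\alpha)\,\Gamma(n_{z1}+\alpha)}\cdot\frac{\Gamma(\alpha)^2}{\Gamma(2\alpha)},\qquad n_z=n_{z0}+n_{z1}$$ (here $\Gamma(\cdot)$ with a real argument is the Gamma function). The recursion terminates with $p_z(D_z)=1$ when $\ell(z)=m$.
   Context: Tree partition. $\Gamma$ is a sample space of total volume $|\Gamma|=1$, $m$ is a finite tree height, and $\mathbb B_k^m=\bigcup_{i=k}^m\{0,1\}^i$ is the set of binary strings of length between $k$ and $m$ (empty if $k>m$). For each $z\in\mathbb B_0^m$ there is a set $\Gamma_z\subseteq\Gamma$, with $\Gamma_\epsilon=\Gamma$ for the empty string $\epsilon$, and for $\ell(z)<m$ the set $\Gamma_z$ is the disjoint union of $\Gamma_{z0}$ and $\Gamma_{z1}$ with $|\Gamma_{z0}|=|\Gamma_{z1}|=\frac12|\Gamma_z|$ (e.g. $\Gamma=[0,1)$ with dyadic intervals). For $x\in\Gamma$, $x_{1:i}$ is the unique string of length $i$ with $x\in\Gamma_{x_{1:i}}$. Write $l=\ell(z)$ for the length of $z$. Models. A model $q$ is a probability distribution on $\Gamma$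 with density constant on each cell $\Gamma_{x'}$, $\ell(x')=m$. It is parametrized by branching probabilities $q_{z0}=P[\Gamma_{z0}|\Gamma_z,q]$ and $q_{z1}=P[\Gamma_{z1}|\Gamma_z,q]$, with $q_{z0}+q_{z1}=1$. Let $\vec q_{z*}:=(q_{zy}:y\in\mathbb B_1^{m-l})$ be the collection of all branching probabilities strictly below node $z$. Prior. Fix parameters $\alpha>0$ and $u,s\in[0,1]$ with $u+s=1$. The prior $p_z(\vec q_{z*})$ (a probability measure, written as a generalized density with Dirac deltas) is defined recursively: $p_z(\vec q_{z*})=1$ if $\ell(z)=m$ (empty collection), and for $\ell(z)<m$ $$p_z(\vec q_{z*})=u\prod_{y\in\mathbb B_1^{m-l}}\delta(q_{zy}-\tfrac12)+s\cdot\mathrm{Beta}(q_{z0},q_{z1}|\alpha,\alpha)\,p_{z0}(\vec q_{z0*})\,p_{z1}(\vec q_{z1*}),$$ where $\mathrm{Beta}(p,q|a,b)=\frac{\Gamma(a+b)}{\Gamma(a)\Gamma(b)}p^{a-1}q^{b-1}\delta(p+q-1)$. That is, with probability $u$ all branching probabilities below $z$ equal $\frac12$; with probability $s$, $q_{z0}=1-q_{z1}$ is $\mathrm{Beta}(\alpha,\alpha)$-distributed and the two subtrees are independent with priors $p_{z0},p_{z1}$. Likelihood and evidence. Data $D=(x^1,\dots,x^n)\in\Gamma^n$; $D_z$ is the sublist (with multiplicity) of data points lying in $\Gamma_z$, and $n_z:=|D_z|$. For $x\in\Gamma_z$, $p_z(x|q):=\prod_{i=l+1}^m 2q_{x_{1:i}}$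 (empty product $=1$; this is the conditional density of $x$ given $\Gamma_z$ scaled by $2^{-l}$), and $p_z(D_z|\vec q_{z*}):=\prod_{x\in D_z}p_z(x|q)$. The evidence is $p_z(D_z):=\int p_z(D_z|\vec q_{z*})\,p_z(\vec q_{z*})\,d\vec q_{z*}$. *)

(* Defs.v *)
From HB Require Import structures.
From mathcomp Require Import all_boot all_order all_algebra.
From mathcomp Require Import all_classical all_reals all_analysis.
Import Order.TTheory GRing.Theory Num.Theory.
Import numFieldNormedType.Exports.

Set Implicit Arguments.
Unset Strict Implicit.
Unset Printing Implicit Defensive.

Local Open Scope classical_set_scope.
Local Open Scope ring_scope.

(* A binary string is a [seq bool], with [false] for the bit 0, [true] for the
   bit 1; the children of the node z are [rcons z false] and [rcons z true]. *)

Record tree_partition (R : realType) (d : measure_display)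
    (X : measurableType d) (vol : {measure set X -> \bar R}) (G : set X)
    (m : nat) (Gam : seq bool -> set X) : Prop := TreePartition {
  tree_partition_vol1 : vol G = 1%E;
  tree_partition_measurable :
    forall z, (size z <= m)%N -> measurable (Gam z);
  tree_partition_root : Gam [::] = G;
  tree_partition_union : forall z, (size z < m)%N ->
    Gam z = Gam (rcons z false) `|` Gam (rcons z true);
  tree_partition_disjoint : forall z, (size z < m)%N ->
    Gam (rcons z false) `&` Gam (rcons z true) = set0;
  tree_partition_half : forall z b, (size z < m)%N ->
    vol (Gam (rcons z b)) = ((2^-1)%:E * vol (Gam z))%E }.

(* x_{1:i}, the string of length i of the cell that contains x *)
Definition cell_addr (X : Type) (Gam : seq bool -> set X) (x : X) (i : nat)
    : seq bool :=
  xget [::] [set y : seq bool | size y = i /\ Gam y x].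

Definition cell_data (d : measure_display) (X : measurableType d)
    (Gam : seq bool -> set X) (D : seq X) (z : seq bool) : seq X :=
  [seq x <- D | x \in Gam z].

Section Branching.
Variable R : realType.

Local Notation dR := (R.-ocitv.-measurable.-sigma)%mdisp.

Fixpoint branching_display (h : nat) : measure_display :=
  match h with
  | 0 => default_measure_display
  | h'.+1 => measure_prod_display
      (measure_prod_display (dR, dR),
       measure_prod_display (branching_display h', branching_display h'))
  end.

(* The space of the collections q_{z*} below a node z of height h = m - l(z):
   a point is ((q_{z0}, q_{z1}), (q_{z0*}, q_{z1*})).  The constraint
   q_{z0} + q_{z1} = 1 is not part of the type; it is carried by the prior. *)
Fixpoint branching (h : nat) : measurableType (branching_display h) :=
  match h return measurableType (branching_display h) with
  | 0 => unit
  | h'.+1 => ((measurableTypeR R * measurableTypeR R) *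
              (branching h' * branching h'))%type
  end.

(* q_{zy} for y of length between 1 and h; the value 0 is junk *)
Fixpoint branch_prob (h : nat) : branching h -> seq bool -> R :=
  match h return branching h -> seq bool -> R with
  | 0 => fun _ _ => 0
  | h'.+1 => fun q y =>
      match y with
      | [::] => 0
      | [:: b] => if b then q.1.2 else q.1.1
      | b :: y' => branch_prob (if b then q.2.2 else q.2.1) y'
      end
  end.

Fixpoint uniform_branching (h : nat) : branching h :=
  match h return branching h with
  | 0 => tt
  | h'.+1 => ((2^-1, 2^-1), (uniform_branching h', uniform_branching h'))
  end.

Definition Gamma_fun (a : R) : R :=
  \int[@lebesgue_measure R]_(t in `]0, +oo[) (t `^ (a - 1) * expR (- t)).

Definition beta_density (a b p q : R) : R :=
  Gamma_fun (a + b) / (Gamma_fun a * Gamma_fun b)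
  * p `^ (a - 1) * q `^ (b - 1).

(* Beta(p, q | a, b) as a distribution of the pair (p, q): the factor
   delta(p + q - 1) means that p has the density beta_density a b p (1 - p) on
   [0, 1] and that q = 1 - p. *)
Definition beta_pair (a b : R) : set (measurableTypeR R * measurableTypeR R)
    -> \bar R :=
  pushforward
    (fun A : set (measurableTypeR R) =>
      \int[@lebesgue_measure R]_(p in A `&` `[0%R, 1%R])
        (beta_density a b p (1 - p))%:E)%E
    (fun p : measurableTypeR R => (p, 1 - p) : (_ * measurableTypeR R)%type).

(* The recursion for p_z sees z only through the height h = m - l(z).  As for
   the library's \x, the definition is a plain set function, which is a
   (probability) measure when 0 < alpha, 0 <= u, 0 <= s and u + s = 1. *)
Fixpoint prior_height (alpha u s : R) (h : nat) : set (branching h) -> \bar R :=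
  match h return set (branching h) -> \bar R with
  | 0 => dirac (tt : branching 0)
  | h'.+1 => fun A =>
      (u%:E * dirac (uniform_branching h'.+1) A
       + s%:E * (beta_pair alpha alpha \x
                  (prior_height alpha u s (h := h') \x
                   prior_height alpha u s (h := h'))) A)%E
  end.

Definition prior (alpha u s : R) (m : nat) (z : seq bool)
    : set (branching (m - size z)) -> \bar R :=
  prior_height alpha u s (h := m - size z).

Definition point_likelihood (X : Type) (Gam : seq bool -> set X) (m : nat)
    (z : seq bool) (q : branching (m - size z)) (x : X) : R :=
  \prod_((size z).+1 <= i < m.+1)
    (2 * branch_prob q (drop (size z) (cell_addr Gam x i))).

Definition likelihood (X : Type) (Gam : seq bool -> set X) (m : nat)
    (z : seq bool) (q : branching (m - size z)) (D : seq X) : R :=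
  \prod_(x <- D) point_likelihood Gam q x.

Definition evidence (X : Type) (Gam : seq bool -> set X) (alpha u s : R)
    (m : nat) (z : seq bool) (D : seq X) : \bar R :=
  (\int[prior alpha u s (m := m) (z := z)]_q (likelihood Gam q D)%:E)%E.

Definition weight (alpha : R) (n0 n1 : nat) : R :=
  2 ^- (n0 + n1)%N
  * (Gamma_fun ((n0 + n1)%N%:R + 2 * alpha)
     / (Gamma_fun (n0%:R + alpha) * Gamma_fun (n1%:R + alpha)))
  * (Gamma_fun alpha ^+ 2 / Gamma_fun (2 * alpha)).

End Branching.

(* Main.v *)
(** Gamma(a) Gamma(b) is a double integral; the substitutions t = x + y and then
    x = t p turn it into B(a, b) Gamma(a + b), which evaluates the Beta integral
    for real exponents and makes [beta_pair alpha alpha] a probability.  By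
    induction on the height the prior is then a probability, namely a mixture of
    a Dirac mass and a product measure.  The likelihood of the data below z
    factors as (2 q_{z0})^{n_{z0}} (2 q_{z1})^{n_{z1}} times the likelihoods of
    the two subtrees; it is 1 at the uniform branching, and Tonelli's theorem
    separates the three factors under the product measure.  The first factor
    integrates to B(alpha + n_{z0}, alpha + n_{z1}) 2^{n_z} / B(alpha, alpha),
    the inverse of the weight. *)

From HB Require Import structures.
Require Import Defs.
From mathcomp Require Import all_boot all_order all_algebra.
From mathcomp Require Import all_classical all_reals all_analysis.
From mathcomp Require Import measurable_realfun ring lra.
Import Order.TTheory GRing.Theory Num.Theory.
Import numFieldNormedType.Exports.

Set Implicit Arguments.
Unset Strict Implicit.
Unset Printing Implicit Defensive.

Local Open Scope classical_set_scope.
Local Open Scope ring_scope.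

(** * The Gamma and Beta integrals *)

Section affine_substitution.
Variable R : realType.
Local Notation mu := (@lebesgue_measure R).

(** As a function of [A], the left side is [c] times a pushforward of Lebesgue measure. It gives
    half-open intervals their length, and Lebesgue measure is the only measure that does so. *)
Lemma lebesgue_measure_affine (c e : R) (A : set (measurableTypeR R)) :
  0 < c -> measurable A ->
  (c%:E * mu [set x | A (c * x + e)%R])%E = mu A.
Proof.
move=> c0 mA.
pose phi : measurableTypeR R -> measurableTypeR R := fun x => c * x + e.
have mphi : measurable_fun setT phi.
  by apply: measurable_funD => //; exact: mulrl_measurable.
pose nu := mscale (NngNum (ltW c0)) (pushforward mu phi).
suff : mu A = nu mphi A by move=> ->.
apply: lebesgue_measure_unique => // _ [[a b] _ <-].
rewrite -[RHS]/(c%:E * mu (phi @^-1` [set` `]a, b]]))%E.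
have -> : phi @^-1` [set` `]a, b]] = [set` `](a - e) / c, (b - e) / c]].
  apply/seteqP; split => x /=; rewrite !in_itv/= /phi => /andP[ax xb];
  rewrite ltr_pdivrMr// ler_pdivlMr// in ax xb *; apply/andP; split; lra.
rewrite !lebesgue_measure_itv/= !lte_fin ltr_pM2r ?invr_gt0// ltrD2r.
case: ifPn => ab; rewrite ?mule0// -!EFinB -EFinM; congr (_%:E).
by field; rewrite gt_eqF.
Qed.

Lemma ge0_integral_affine (c e : R) (f : R -> \bar R) :
  0 < c -> measurable_fun [set: R] f -> (forall x, (0 <= f x)%E) ->
  (\int[mu]_x f x = c%:E * \int[mu]_x f (c * x + e)%R)%E.
Proof.
move=> c0 mf f0.
pose phi : measurableTypeR R -> measurableTypeR R := fun x => c * x + e.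
have mphi : measurable_fun setT phi.
  by apply: measurable_funD => //; exact: mulrl_measurable.
pose nu := mscale (NngNum (ltW c0)) (pushforward mu phi).
transitivity (\int[nu mphi]_x f x)%E.
  by apply: eq_measure_integral => // A mA _; exact/esym/lebesgue_measure_affine.
rewrite /nu ge0_integral_mscale//=; congr (_ * _)%E.
by rewrite ge0_integral_pushforward.
Qed.

End affine_substitution.

Section gamma_function.
Variable R : realType.
Local Notation mu := (@lebesgue_measure R).

(* Cutting x ^ (a - 1) off at 0 turns all Gamma and Beta integrals into integrals
   over the whole line, on which Lebesgue measure scales under affine maps. *)
Definition pos_power (a x : R) : R := x `^ (a - 1) * \1_`]0, +oo[ x.

Lemma pos_power_gt0E (a x : R) : 0 < x -> pos_power a x = x `^ (a - 1).
Proof.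
by move=> x0; rewrite /pos_power indicE mem_set ?mulr1//= in_itv/= x0.
Qed.

Lemma pos_power_le0E (a x : R) : x <= 0 -> pos_power a x = 0.
Proof.
by move=> x0; rewrite /pos_power indicE memNset ?mulr0//= in_itv/= ltNge x0.
Qed.

Lemma pos_power_ge0 (a x : R) : 0 <= pos_power a x.
Proof. by rewrite mulr_ge0// powR_ge0. Qed.

Lemma measurable_pos_power (a : R) : measurable_fun [set: R] (pos_power a).
Proof.
by apply: measurable_funM; [exact: measurable_powR|exact: measurable_indic].
Qed.

Lemma pos_powerM (a t x : R) : 0 < t ->
  pos_power a (t * x) = t `^ (a - 1) * pos_power a x.
Proof.
move=> t0; have [x0|x0] := leP x 0.
  by rewrite !pos_power_le0E ?mulr0// mulr_ge0_le0// ltW.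
by rewrite !pos_power_gt0E ?mulr_gt0// powRM// ltW.
Qed.

(** Kept in the extended reals, so that Tonelli's theorem applies before finiteness is known;
    [Gamma_fun] is its real part. *)
Definition Gamma_integral (a : R) : \bar R :=
  (\int[mu]_x (pos_power a x * expR (- x))%:E)%E.

Lemma measurable_Gamma_integrand (a : R) :
  measurable_fun [set: R] (fun x => pos_power a x * expR (- x)).
Proof.
apply: measurable_funM; first exact: measurable_pos_power.
by apply: measurableT_comp; [exact: measurable_expR|exact: oppr_measurable].
Qed.

Lemma Gamma_integral_itv (a : R) :
  (\int[mu]_(t in `]0%R, +oo[) (t `^ (a - 1) * expR (- t))%:E
   = Gamma_integral a)%E.
Proof.
rewrite integral_mkcond; apply: eq_integral => x _; rewrite patchE.
case: ifPn; first by rewrite inE/= in_itv/= andbT => x0; rewrite pos_power_gt0E.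
rewrite notin_setE/= in_itv/= andbT => /negP; rewrite -leNgt => x0.
by rewrite pos_power_le0E// mul0r.
Qed.

(** The antiderivative [a^-1 * x ^ a] settles each compact interval inside []0, 1]], and monotone
    convergence passes to the union. *)
Lemma integral_powR_01_le (a : R) : 0 < a ->
  (\int[mu]_(x in `]0%R, 1%R]) (x `^ (a - 1))%:E <= (a^-1)%:E)%E.
Proof.
(* The shift by 2 keeps the left endpoint strictly below 1 even at [n = 0], as the fundamental
   theorem of calculus requires. *)
move=> a0; pose F n : set (measurableTypeR R) := `[(n.+2%:R^-1 : R), 1]%classic.
have mf (D : set (measurableTypeR R)) :
    measurable D -> measurable_fun D (fun x : R => (x `^ (a - 1))%:E).
  move=> mD; apply/measurable_EFinP; apply: measurable_funTS.
  exact: measurable_powR.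
have F01 : \bigcup_i F i = `]0%R, 1%R]%classic :> set (measurableTypeR R).
  apply/seteqP; split=> [x [n _]|x]; rewrite /F /= !in_itv/=.
    by move=> /andP[nx ->]; rewrite (lt_le_trans _ nx).
  move=> /andP[x0 x1]; exists (Num.truncn x^-1) => //=; rewrite in_itv/= x1 andbT.
  rewrite invf_ple ?posrE// ltW// (lt_le_trans (truncnS_gt _))// ler_nat.
  by rewrite ltnW.
have cvgF : (\int[mu]_(x in F n) (x `^ (a - 1))%:E @[n --> \oo] -->
             \int[mu]_(x in \bigcup_n F n) (x `^ (a - 1))%:E)%E.
  apply: ge0_nondecreasing_set_cvg_integral.
  - move=> m n mn; apply/subsetPset => x; rewrite /F/= !in_itv/= => /andP[mx ->].
    by rewrite (le_trans _ mx)// lef_pV2 ?posrE// ler_nat !ltnS.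
  - by move=> i; exact: measurable_itv.
  - by move=> i; apply: mf; exact: measurable_itv.
  - by move=> i x _; rewrite lee_fin powR_ge0.
rewrite -F01 -(cvg_lim _ cvgF)//; apply: lime_le.
  by apply/cvg_ex; eexists; exact: cvgF.
apply: nearW => n.
have n0 : 0 < (n.+2%:R^-1 : R) by rewrite invr_gt0.
have n1 : (n.+2%:R^-1 : R) < 1 by rewrite invf_lt1// ltr1n.
have n_oo (x : R) : x \in `]n.+2%:R^-1, 1[ -> 0 < x.
  by rewrite in_itv/= => /andP[nx _]; exact: lt_trans nx.
have cpow (b : R) : {within `[n.+2%:R^-1, 1], continuous (fun x : R => x `^ b)}.
  apply: continuous_in_subspaceT => x; rewrite inE/= in_itv/= => /andP[nx _].
  apply: differentiable_continuous; apply/derivable1_diffP.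
  apply: derivable_powR.
  by rewrite in_itv/= andbT (lt_le_trans n0).
rewrite (@continuous_FTC2 _ _ (fun x => a^-1 * x `^ a))//.
- by rewrite powR1 mulr1 -EFinB lee_fin gerBl mulr_ge0 ?powR_ge0// invr_ge0 ltW.
- have /continuous_within_itvP := cpow a; move=> /(_ n1)[_ cl cr].
  split.
  + move=> x /n_oo x0; apply: derivableM => //.
    by apply: derivable_powR; rewrite in_itv/= x0.
  + by apply: cvgM => //; exact: cvg_cst.
  + by apply: cvgM => //; exact: cvg_cst.
- move=> x /n_oo x0; rewrite derive1E deriveZ/=; last first.
    by apply: derivable_powR; rewrite in_itv/= x0.
  rewrite -derive1E powR_derive1 ?in_itv/= ?x0//.
  by rewrite /GRing.scale/= mulrA mulVf ?gt_eqF// mul1r.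
Qed.

Lemma Gamma_integral_ge0 (a : R) : (0 <= Gamma_integral a)%E.
Proof.
by apply: integral_ge0 => x _; rewrite lee_fin mulr_ge0 ?pos_power_ge0 ?expR_ge0.
Qed.

(** A single term of the exponential series at [t / 2] dominates the power of [t]; half of the
    exponential decay remains for integrability. *)
Lemma powR_expR_le (a t : R) (N : nat) : 1 <= t -> a - 1 <= N.+1%:R ->
  t `^ (a - 1) * expR (- t) <= N.+1`!%:R * 2 ^+ N.+1 * expR (- (t / 2)).
Proof.
move=> t1 aN; have t0 : 0 < t by exact: lt_le_trans t1.
have tN : t `^ (a - 1) <= t ^+ N.+1.
  by rewrite -(powR_mulrn _ (ltW t0)); exact: ler_powR.
have eN : t ^+ N.+1 <= N.+1`!%:R * 2 ^+ N.+1 * expR (t / 2).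
  have t20 : 0 <= t / 2 by rewrite divr_ge0// ltW.
  have : (t / 2) ^+ N.+1 / N.+1`!%:R <= expR (t / 2).
    by apply: le_trans (expR_ge1Dxn N t20); rewrite lerDr.
  rewrite exprMn exprVn ler_pdivrMr ?ltr0n ?fact_gt0//.
  by rewrite ler_pdivrMr ?exprn_gt0// -mulrA mulrC.
apply: (le_trans (ler_wpM2r (expR_ge0 _) (le_trans tN eN))).
rewrite -[leLHS]mulrA -expRD le_eqVlt; apply/orP; left; apply/eqP.
by congr (_ * expR _); lra.
Qed.

(** Up to the factor 1/2 the integrand is the exponential density of rate 1/2, whose total mass is
    1. *)
Lemma integral_expR_half_lty :
  (\int[mu]_(x in `[0%R, +oo[) (expR (- (x / 2)))%:E < +oo)%E.
Proof.
have h0 : (0 : R) < 2^-1 by rewrite invr_gt0.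
have := integral_exponential_pdf h0.
rewrite (_ : (\int[mu]_x _)%E =
    (\int[mu]_(x in `[0%R, +oo[) ((2^-1)%:E * (expR (- (x / 2)))%:E))%E); last first.
  rewrite [RHS]integral_mkcond; apply: eq_integral => x _.
  rewrite /exponential_pdf !patchE; case: ifPn => // _.
  by rewrite -EFinM mulNr (mulrC x).
rewrite ge0_integralZl//=; last first.
  apply: measurable_funTS; apply/measurable_EFinP.
  apply: measurableT_comp; first exact: measurable_expR.
  by apply: measurableT_comp; [exact: oppr_measurable|exact: mulrr_measurable].
move=> H; rewrite ltey; apply/eqP => I; move: H.
by rewrite I mulry gtr0_sg// mul1e.
Qed.

(** The integral is cut at 1: the power alone dominates on []0, 1]], an exponential beyond. *)
Lemma Gamma_integral_lty (a : R) : 0 < a -> (Gamma_integral a < +oo)%E.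
Proof.
move=> a0; rewrite -Gamma_integral_itv.
have mG (D : set (measurableTypeR R)) : measurable D ->
    measurable_fun D (fun t : R => (t `^ (a - 1) * expR (- t))%:E).
  move=> mD; apply/measurable_EFinP; apply: measurable_funTS.
  apply: measurable_funM; first exact: measurable_powR.
  by apply: measurableT_comp; [exact: measurable_expR|exact: oppr_measurable].
rewrite (_ : `]0%R, +oo[%classic = `]0%R, 1%R] `|` `]1%R, +oo[); last first.
  by rewrite -itv_bndbnd_setU ?bnd_simp.
rewrite ge0_integral_setU//=; last 3 first.
- by apply: mG; apply: measurableU; exact: measurable_itv.
- by move=> x _; rewrite lee_fin mulr_ge0 ?powR_ge0 ?expR_ge0.
- by apply/disj_setPS => x []/=; rewrite !in_itv/= => /andP[_ x1]; rewrite ltNge x1.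
apply: lte_add_pinfty.
  apply: le_lt_trans (ltry a^-1); apply: le_trans (integral_powR_01_le a0).
  apply: ge0_le_integral => //.
  - by move=> x _; rewrite lee_fin mulr_ge0 ?powR_ge0 ?expR_ge0.
  - exact: mG.
  - by apply/measurable_EFinP; apply: measurable_funTS; exact: measurable_powR.
  - move=> x /=; rewrite in_itv/= => /andP[x0 _]; rewrite lee_fin.
    by rewrite ler_piMr ?powR_ge0// -expR0 ler_expR oppr_le0 ltW.
have [N aN] : exists N : nat, a - 1 <= N.+1%:R.
  by exists (Num.truncn (a - 1)); rewrite ltW// truncnS_gt.
have mE (D : set (measurableTypeR R)) :
    measurable_fun D (fun x : R => (expR (- (x / 2)))%:E).
  apply: measurable_funTS; apply/measurable_EFinP.
  apply: measurableT_comp; first exact: measurable_expR.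
  by apply: measurableT_comp; [exact: oppr_measurable|exact: mulrr_measurable].
apply: (@le_lt_trans _ _ (\int[mu]_(x in `]1%R, +oo[)
   ((N.+1`!%:R * 2 ^+ N.+1)%:E * (expR (- (x / 2)))%:E))%E).
  apply: ge0_le_integral => //.
  - by move=> x _; rewrite lee_fin mulr_ge0 ?powR_ge0 ?expR_ge0.
  - exact: mG.
  - by apply: measurable_funeM; exact: mE.
  - move=> x /=; rewrite in_itv/= andbT => x1.
    by rewrite -EFinM lee_fin powR_expR_le// ltW.
rewrite ge0_integralZl//=.
apply: lte_mul_pinfty => //.
apply: le_lt_trans integral_expR_half_lty.
apply: ge0_subset_integral => //=.
by move=> x /=; rewrite !in_itv/= !andbT => x1; rewrite (le_trans ler01)// ltW.
Qed.

Lemma Gamma_integral_gt0 (a : R) : (0 < Gamma_integral a)%E.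
Proof.
rewrite lt_neqAle Gamma_integral_ge0 andbT; apply/eqP => /esym G0.
have m01 : (@measurable _ (measurableTypeR R)) `]0%R, 1%R] by exact: measurable_itv.
have mG := measurable_Gamma_integrand a.
have : (\int[mu]_(x in `]0%R, 1%R]) `|(pos_power a x * expR (- x))%:E| = 0)%E.
  apply/eqP; rewrite eq_le integral_ge0// andbT -G0.
  rewrite /Gamma_integral.
  rewrite [leRHS](_ : _ = \int[mu]_x `|(pos_power a x * expR (- x))%:E|)%E; last first.
    apply: eq_integral => x _; rewrite gee0_abs// lee_fin.
    by rewrite mulr_ge0 ?pos_power_ge0 ?expR_ge0.
  apply: ge0_subset_integral => //=.
  by apply/measurable_EFinP; exact: measurableT_comp.
have mG01 : measurable_fun (`]0%R, 1%R]%classic : set (measurableTypeR R))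
    (fun x : R => (pos_power a x * expR (- x))%:E).
  by apply/measurable_EFinP; exact: measurable_funTS.
have [ae0 _] := ae_eq_integral_abs mu m01 mG01.
move=> /ae0[N [mN N0 sN]].
(* The integrand is positive on []0, 1]], so the null set [N] off which it vanishes there would
   contain an interval of length 1. *)
have : (mu `]0%R, 1%R] <= mu N)%E.
  apply: le_measure; rewrite ?inE// => x /=; rewrite in_itv/= => /andP[x0 x1].
  apply: sN => /=; rewrite in_itv/= x0 x1 => /(_ isT)/eqP; rewrite eqe.
  by rewrite mulf_eq0 expR_eq0 orbF pos_power_gt0E// powR_eq0 gt_eqF.
by rewrite N0 lebesgue_measure_itv/= lte_fin ltr01 oppr0 adde0 lee_fin ler10.
Qed.

Definition Beta_integral (a b : R) : \bar R :=
  (\int[mu]_x (pos_power a x * pos_power b (1 - x))%:E)%E.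

Lemma measurable_Beta_integrand (a b : R) :
  measurable_fun [set: R] (fun x => pos_power a x * pos_power b (1 - x)).
Proof.
apply: measurable_funM; first exact: measurable_pos_power.
by apply: measurableT_comp; [exact: measurable_pos_power|exact: measurable_funB].
Qed.

Lemma Beta_integral_ge0 (a b : R) : (0 <= Beta_integral a b)%E.
Proof. by apply: integral_ge0 => x _; rewrite lee_fin mulr_ge0 ?pos_power_ge0. Qed.

(** The integrand of Gamma(a) Gamma(b) at the point [(x, t)] with [t = x + y]: the exponentials of
    [- x] and [- y] merge into that of [- t]. *)
Let convolution (a b : R) (xt : R * R) : R :=
  pos_power a xt.1 * pos_power b (xt.2 - xt.1) * expR (- xt.2).

Let measurable_convolution (a b : R) :
  measurable_fun [set: (measurableTypeR R * measurableTypeR R)%type]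
    (fun xt => (convolution a b xt)%:E).
Proof.
apply/measurable_EFinP; apply: measurable_funM; [apply: measurable_funM|].
- by apply: measurableT_comp; [exact: measurable_pos_power|exact: measurable_fst].
- apply: measurableT_comp; first exact: measurable_pos_power.
  by apply: measurable_funB; [exact: measurable_snd|exact: measurable_fst].
- apply: measurableT_comp; first exact: measurable_expR.
  by apply: measurableT_comp; [exact: oppr_measurable|exact: measurable_snd].
Qed.

Let convolution_ge0 (a b : R) (xt : R * R) : (0 <= (convolution a b xt)%:E)%E.
Proof. by rewrite lee_fin mulr_ge0 ?expR_ge0// mulr_ge0 ?pos_power_ge0. Qed.

(** For [t > 0] the substitution [x = t p] extracts the powers of [t], with one more factor [t] from
    the Jacobian. For [t <= 0] one of [x] and [t - x] is always nonpositive, so both sides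
    vanish. *)
Let integral_convolution (a b t : R) :
  (\int[mu]_x (convolution a b (x, t))%:E =
   (pos_power (a + b) t * expR (- t))%:E * Beta_integral a b)%E.
Proof.
have [t0|t0] := leP t 0.
  rewrite pos_power_le0E// mul0r mul0e integral0_eq// => x _.
  rewrite /convolution/=; have [x0|x0] := leP x 0.
    by rewrite pos_power_le0E// !mul0r.
  by rewrite [pos_power b _]pos_power_le0E ?mulr0 ?mul0r//; lra.
rewrite (@ge0_integral_affine _ t 0)//; last first.
  by move: (measurable_convolution a b) => /measurable_fun_pair1; exact.
transitivity (t%:E * \int[mu]_x ((t `^ (a - 1) * t `^ (b - 1) * expR (- t))%:E
    * (pos_power a x * pos_power b (1 - x))%:E))%E.
  congr (_ * _)%E; apply: eq_integral => x _.
  rewrite /convolution/= addr0 -EFinM (_ : t - t * x = t * (1 - x)); last by ring.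
  by rewrite !pos_powerM//; congr (_%:E); ring.
rewrite ge0_integralZl//=; last 3 first.
- by apply/measurable_EFinP; exact: measurable_Beta_integrand.
- by move=> x _; rewrite lee_fin mulr_ge0 ?pos_power_ge0.
- by rewrite lee_fin mulr_ge0 ?expR_ge0// mulr_ge0 ?powR_ge0.
rewrite muleA -EFinM pos_power_gt0E//; congr (_%:E * _)%E.
have tD r r' : t `^ (r + r') = t `^ r * t `^ r'.
  by apply: powRD; rewrite (gt_eqF t0) implybT.
rewrite (_ : a + b - 1 = 1 + (a - 1) + (b - 1)); last by ring.
by rewrite !tD powRr1 ?ltW// !mulrA.
Qed.

Lemma Gamma_integralM (a b : R) :
  (Gamma_integral a * Gamma_integral b =
   Beta_integral a b * Gamma_integral (a + b))%E.
Proof.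
pose g (c x : R) := pos_power c x * expR (- x).
have g0 c x : (0 <= (g c x)%:E)%E.
  by rewrite lee_fin mulr_ge0 ?pos_power_ge0 ?expR_ge0.
have mg c : measurable_fun [set: R] (fun x => (g c x)%:E).
  by apply/measurable_EFinP; exact: measurable_Gamma_integrand.
rewrite [in LHS]/Gamma_integral -ge0_integralZr ?Gamma_integral_ge0//; last 2 first.
- exact: mg.
- by move=> x _; exact: g0.
transitivity (\int[mu]_x \int[mu]_t (convolution a b (x, t))%:E)%E.
  apply: eq_integral => x _; rewrite -ge0_integralZl//; last 3 first.
  - exact: mg.
  - by move=> y _; exact: g0.
  - exact: g0.
  (* The translation [y = t - x] at fixed [x]. *)
  rewrite [LHS](@ge0_integral_affine _ 1 (- x))// ?mul1e; last 2 first.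
  - by apply: measurable_funeM; exact: mg.
  - by move=> y; apply: mule_ge0; exact: g0.
  apply: eq_integral => t _; rewrite /convolution/= -EFinM mul1r; congr (_%:E).
  by rewrite mulrACA -expRD; congr (_ * expR _); ring.
(* After the exchange of the integrals the inner one runs over [x] at fixed [t], as in
   [integral_convolution]. *)
rewrite [LHS](@fubini_tonelli _ _ _ _ _ mu mu
  (fun xt : measurableTypeR R * measurableTypeR R => (convolution a b xt)%:E))//.
under eq_integral do rewrite integral_convolution.
rewrite muleC -ge0_integralZr ?Beta_integral_ge0//; first exact: mg.
by move=> x _; exact: g0.
Qed.

Lemma Gamma_funE (a : R) : Gamma_fun a = fine (Gamma_integral a).
Proof. by rewrite -Gamma_integral_itv. Qed.

Lemma Gamma_fun_gt0 (a : R) : 0 < a -> 0 < Gamma_fun a.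
Proof.
move=> a0; rewrite Gamma_funE fine_gt0//.
by rewrite Gamma_integral_gt0 Gamma_integral_lty.
Qed.

Lemma Beta_integralE (a b : R) : 0 < a -> 0 < b ->
  Beta_integral a b = (Gamma_fun a * Gamma_fun b / Gamma_fun (a + b))%:E.
Proof.
move=> a0 b0; have ab0 := addr_gt0 a0 b0.
have GE c : 0 < c -> Gamma_integral c = (Gamma_fun c)%:E.
  move=> c0; rewrite Gamma_funE fineK// ge0_fin_numE ?Gamma_integral_ge0//.
  exact: Gamma_integral_lty.
have := Gamma_integralM a b; rewrite !GE//.
have G0 := Gamma_fun_gt0 ab0.
have : (0 <= Beta_integral a b)%E := Beta_integral_ge0 a b.
(* An infinite Beta integral would make the right side of [Gamma_integralM] infinite, whereas the
   left side is a product of two reals. *)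
case: Beta_integral => [r _|_|//].
  by rewrite -!EFinM => -[->]; rewrite mulfK// gt_eqF.
by rewrite mulyr gtr0_sg// mul1e.
Qed.

End gamma_function.

(** * The Beta distribution of a branching pair *)

Section density_measure.
Local Open Scope ereal_scope.
Context d (T : measurableType d) (R : realType).
Variables (mu : {measure set T -> \bar R}) (f : T -> R).
Hypotheses (mf : measurable_fun setT f) (f0 : forall x, (0 <= f x)%R).

Let Ef x : \bar R := (f x)%:E.

Let Ef0 x : 0 <= Ef x. Proof. by rewrite lee_fin. Qed.

Let mEf : measurable_fun setT Ef. Proof. exact/measurable_EFinP. Qed.

(* The proofs are arguments so that the measure structure can be inferred from
   the term. *)
Definition density_measure of (measurable_fun setT f) & (forall x, (0 <= f x)%R) :=
  fun A : set T => \int[mu]_(x in A) (f x)%:E.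

Local Notation nu := (density_measure mf f0).

Let nu0 : nu set0 = 0. Proof. exact: integral_set0. Qed.

Let nu_ge0 A : 0 <= nu A. Proof. by apply: integral_ge0 => x _; exact: Ef0. Qed.

Let nu_sigma_additive : semi_sigma_additive nu.
Proof.
move=> F mF tF mUF; apply: cvg_toP.
  apply: ereal_nondecreasing_is_cvgn => m n mn.
  by apply: lee_sum_nneg_natr => // k _ _; exact: nu_ge0.
rewrite /density_measure (@ge0_integral_bigcup _ _ _ _ F Ef)//.
exact: measurable_funTS.
Qed.

HB.instance Definition _ := isMeasure.Build _ _ _ nu
  nu0 nu_ge0 nu_sigma_additive.

Import HBNNSimple.

(** Both sides are limits, by monotone convergence, of their values at simple functions increasing
    to [g]; for a simple function the claim is linearity over its level sets. *)
Lemma ge0_integral_density (g : T -> \bar R) :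
  measurable_fun setT g -> (forall x, 0 <= g x) ->
  \int[nu]_x g x = \int[mu]_x (g x * (f x)%:E).
Proof.
move=> mg g0; pose g_ := nnsfun_approx measurableT mg.
have limg x : limn (EFin \o g_^~ x) = g x.
  by apply/cvg_lim => //; exact: cvg_nnsfun_approx.
have gn0 n x : 0 <= (g_ n x)%:E by rewrite lee_fin.
have ndg x : {homo (fun n => (g_ n x)%:E) : m n / (m <= n)%N >-> m <= n}.
  by move=> m n mn; rewrite lee_fin; exact/lefP/nd_nnsfun_approx.
have mgn n : measurable_fun setT (fun x => (g_ n x)%:E) by exact/measurable_EFinP.
pose gf n x := (g_ n x)%:E * Ef x.
have gfE x : g x * (f x)%:E = limn (gf ^~ x).
  apply/esym/cvg_lim => //; apply: cvgeZr => //.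
  exact: cvg_nnsfun_approx.
have mgf n : measurable_fun setT (gf n) by exact: emeasurable_funM.
have gf0 n x : 0 <= gf n x by rewrite mule_ge0.
have ndgf x : {homo gf ^~ x : m n / (m <= n)%N >-> m <= n}.
  by move=> m n mn; rewrite lee_wpmul2r// ndg.
under [RHS]eq_integral do rewrite gfE.
rewrite [RHS](monotone_convergence mu measurableT mgf (fun n x _ => gf0 n x)
  (fun x _ => ndgf x)).
under [LHS]eq_integral do rewrite -limg.
rewrite [LHS](monotone_convergence (nu : {measure set T -> \bar R})
  measurableT mgn (fun n x _ => gn0 n x) (fun x _ => ndg x)).
congr (limn _); apply/funext => n.
have mI k : measurable (g_ n @^-1` [set k]) by exact: measurable_sfunP.
transitivity (\sum_(k \in range (g_ n)) k%:E * nu (g_ n @^-1` [set k])).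
  by rewrite integralT_nnsfun sintegralE.
transitivity (\sum_(k \in range (g_ n))
    \int[mu]_x ((k * \1_(g_ n @^-1` [set k]) x)%:E * Ef x)).
  apply: eq_fsbigr => k; rewrite inE/= => -[y _ <-].
  rewrite /density_measure integral_mkcond -ge0_integralZl//; last 2 first.
  - by apply/(measurable_restrictT _ _).1 => //; exact: measurable_funTS.
  - by move=> x _; apply: erestrict_ge0 => y0 _; exact: Ef0.
  apply: eq_integral => x _; rewrite patchE indicE.
  by case: ifPn => _; rewrite ?mulr1 ?mulr0 ?mule0 ?mul0e.
rewrite -ge0_integral_fsum//.
- apply: eq_integral => x _; rewrite -ge0_mule_fsuml//; last first.
    by move=> k; rewrite nnfun_muleindic_ge0.
  by rewrite fsumEFin// -fimfunE.
- move=> k; apply: emeasurable_funM => //; apply/measurable_EFinP.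
  exact: measurable_funM.
- by move=> k x _; rewrite mule_ge0// nnfun_muleindic_ge0.
Qed.

End density_measure.

Section probability_of_measure.
Context d (T : measurableType d) (R : realType).

Variables (m : {measure set T -> \bar R}) (m1 : m setT = 1%E).

Definition unit_measure of (m setT = 1%E) : set T -> \bar R := m.

HB.instance Definition _ := isMeasure.Build _ _ _ (unit_measure m1)
  (measure0 m) (measure_ge0 m) (@measure_semi_sigma_additive _ _ _ m).

HB.instance Definition _ :=
  Measure_isProbability.Build _ _ _ (unit_measure m1) m1.

(** The prior is a plain set function; rewriting it as a bundled probability gives access to the
    integration theorems. *)
Lemma probability_of_measure :
  exists P : probability T R, P = m :> (set T -> \bar R).
Proof. by exists (unit_measure m1 : probability T R). Qed.

End probability_of_measure.

Section beta_pair.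
Variable R : realType.
Local Notation mu := (@lebesgue_measure R).
Local Notation RR := (measurableTypeR R * measurableTypeR R)%type.

Definition beta_pdf01 (a b : R) : R -> R :=
  (fun p => beta_density a b p (1 - p)) \_ `[0, 1].

Lemma measurable_beta_density (a b : R) :
  measurable_fun [set: R] (fun p => beta_density a b p (1 - p)).
Proof.
apply: measurable_funM.
  by apply: measurable_funM; [exact: measurable_cst|exact: measurable_powR].
by apply: (measurableT_comp (@measurable_powR R (b - 1))); exact: measurable_funB.
Qed.

Lemma measurable_beta_pdf01 (a b : R) : measurable_fun [set: R] (beta_pdf01 a b).
Proof.
apply/(measurable_restrictT _ _).1; first exact: measurable_itv.
by apply: measurable_funTS; exact: measurable_beta_density.
Qed.

Lemma beta_density_ge0 (a b p q : R) : 0 < a -> 0 < b -> 0 <= beta_density a b p q.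
Proof.
move=> a0 b0; rewrite /beta_density mulr_ge0 ?powR_ge0// mulr_ge0 ?powR_ge0//.
by rewrite divr_ge0 ?mulr_ge0// ltW// Gamma_fun_gt0// addr_gt0.
Qed.

Lemma beta_pdf01_ge0 (a b : R) : 0 < a -> 0 < b -> forall p, 0 <= beta_pdf01 a b p.
Proof. by move=> a0 b0 p; apply: restrict_ge0 => x _; exact: beta_density_ge0. Qed.

(** Up to the constant [C], the integral is the Beta integral at [a + i] and [a + j]. The norms
    change nothing on [[0, 1]], where the density lives, and make the integrand nonnegative on the
    whole line. *)
Lemma integral_beta_moment (a : R) (i j : nat) : 0 < a ->
  (\int[mu]_p ((`|2 * p| ^+ i * `|2 * (1 - p)| ^+ j)%:E * (beta_pdf01 a a p)%:E)
   = ((weight a i j)^-1)%:E)%E.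
Proof.
move=> a0.
have ai0 : 0 < a + i%:R by rewrite ltr_wpDr.
have aj0 : 0 < a + j%:R by rewrite ltr_wpDr.
pose C : R := 2 ^+ (i + j) * (Gamma_fun (a + a) / (Gamma_fun a * Gamma_fun a)).
have C0 : 0 <= C.
  rewrite mulr_ge0 ?exprn_ge0// divr_ge0 ?mulr_ge0// ltW// Gamma_fun_gt0//.
  exact: addr_gt0.
pose F p : R := C * (pos_power (a + i%:R) p * pos_power (a + j%:R) (1 - p)).
have mF : measurable_fun [set: R] F.
  by apply: measurable_funM; [exact: measurable_cst|exact: measurable_Beta_integrand].
pose G p : R := `|2 * p| ^+ i * `|2 * (1 - p)| ^+ j * beta_density a a p (1 - p).
have mG : measurable_fun [set: R] G.
  apply: measurable_funM; first apply: measurable_funM.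
  - by apply: measurable_funX; apply: measurableT_comp => //; exact: mulrl_measurable.
  - apply: measurable_funX; apply: measurableT_comp => //.
    by apply: measurable_funM => //; exact: measurable_funB.
  - exact: measurable_beta_density.
have GF p : 0 < p < 1 -> G p = F p.
  move=> /andP[p0 p1]; have q0 : 0 < 1 - p by rewrite subr_gt0.
  rewrite /G /F !pos_power_gt0E// ger0_norm ?mulr_ge0 ?ltW//.
  rewrite ger0_norm ?mulr_ge0 ?ltW//.
  have E (x : R) k : 0 < x -> x `^ (a + k%:R - 1) = x `^ (a - 1) * x ^+ k.
    move=> x0; rewrite -powR_mulrn ?ltW// -powRD ?(gt_eqF x0) ?implybT//.
    by congr (_ `^ _); ring.
  by rewrite !E// /C /beta_density exprD !exprMn; ring.
transitivity (\int[mu]_(p in `[0%R, 1%R]) (G p)%:E)%E.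
  rewrite [RHS]integral_mkcond; apply: eq_integral => p _.
  by rewrite /beta_pdf01 !patchE; case: ifPn => _; rewrite ?mule0// -EFinM.
(* The endpoints are dropped because [G] and [F] may differ there: [pos_power] vanishes at 0, but
   the power of 0 to the exponent 0 is 1. *)
rewrite integral_itv_bndoo; last by apply/measurable_EFinP; exact: measurable_funTS.
transitivity (\int[mu]_(p in `]0%R, 1%R[) (F p)%:E)%E.
  by apply: eq_integral => p; rewrite inE/= in_itv/= => p01; rewrite GF.
transitivity (\int[mu]_p (F p)%:E)%E.
  rewrite integral_mkcond; apply: eq_integral => p _; rewrite patchE.
  case: ifPn => //; rewrite notin_setE/= in_itv/= /F => /negP.
  rewrite negb_and -!leNgt => /orP[p0|p1].
    by rewrite pos_power_le0E// mul0r mulr0.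
  by rewrite [pos_power _ (1 - p)]pos_power_le0E ?mulr0// subr_le0.
transitivity (C%:E * Beta_integral (a + i%:R) (a + j%:R))%E.
  rewrite -ge0_integralZl//.
  - by apply/measurable_EFinP; exact: measurable_Beta_integrand.
  - by move=> p _; rewrite lee_fin mulr_ge0 ?pos_power_ge0.
rewrite Beta_integralE// -EFinM; congr (_%:E).
rewrite /weight /C natrD.
rewrite (_ : a + i%:R + (a + j%:R) = i%:R + j%:R + 2 * a); last by ring.
rewrite (addrC i%:R a) (addrC j%:R a) (_ : a + a = 2 * a); last by ring.
have G0 x : 0 < x -> Gamma_fun x != 0 by move=> x0; rewrite gt_eqF// Gamma_fun_gt0.
by field; rewrite !G0 ?expf_neq0 ?mulr_gt0// ?ltr_wpDl ?addr_ge0 ?mulr_gt0.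
Qed.

Lemma beta_pair_probability (a : R) : 0 < a ->
  exists P : probability RR R,
    P = beta_pair a a :> (set RR -> \bar R) /\
    forall g : RR -> \bar R, measurable_fun setT g -> (forall x, 0 <= g x)%E ->
    (\int[P]_x g x = \int[mu]_p (g (p, (1 - p)%R) * (beta_pdf01 a a p)%:E))%E.
Proof.
move=> a0.
pose phi (p : measurableTypeR R) : RR := (p, 1 - p).
have mphi : measurable_fun setT phi.
  by apply: measurable_fun_pair => //; exact: measurable_funB.
pose nu := density_measure mu (measurable_beta_pdf01 a a) (beta_pdf01_ge0 a0 a0).
pose pnu : {measure set RR -> \bar R} :=
  measure_function_pushforward__canonical__measure_function_Measure nu mphi.
have nuE : pnu = beta_pair a a :> (set RR -> \bar R).
  apply/funext => A; rewrite /beta_pair /pushforward integral_mkcondr.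
  rewrite restrict_EFin.
  by [].
have intE g : measurable_fun setT g -> (forall x, 0 <= g x)%E ->
    (\int[pnu]_x g x = \int[mu]_p (g (p, (1 - p)%R) * (beta_pdf01 a a p)%:E))%E.
  move=> mg g0; rewrite ge0_integral_pushforward//=.
  rewrite ge0_integral_density//.
  exact: measurableT_comp mg mphi.
(* The total mass is the moment with [i = j = 0], and [weight a 0 0] is 1. *)
have [|P PE] := @probability_of_measure _ _ _ pnu.
  rewrite -[LHS]mul1e -integral_cst// intE//.
  transitivity (((weight a 0 0)^-1)%:E : \bar R).
    rewrite -(integral_beta_moment 0 0 a0); apply: eq_integral => p _.
    by rewrite !expr0 mulr1.
  congr (_%:E); rewrite /weight !add0r expr0 invr1 mul1r.
  by field; rewrite !gt_eqF ?Gamma_fun_gt0 ?mulr_gt0.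
exists P; split; first by rewrite PE nuE.
by move=> g mg g0; rewrite -intE// PE.
Qed.

End beta_pair.

(** * The prior *)

Section prior.
Variables (R : realType) (alpha u s : R).
Hypotheses (alpha0 : 0 < alpha) (u0 : 0 <= u) (s0 : 0 <= s) (us1 : u + s = 1).
Local Notation mu := (@lebesgue_measure R).
Local Notation RR := (measurableTypeR R * measurableTypeR R)%type.
Local Notation prior_ h := (@prior_height R alpha u s h).

Lemma mixture_probability d (T : measurableType d) (P Q : probability T R) :
  exists M : probability T R,
    (forall A, M A = (u%:E * P A + s%:E * Q A)%E) /\
    forall g, measurable_fun setT g -> (forall x, 0 <= g x)%E ->
      (\int[M]_x g x = u%:E * \int[P]_x g x + s%:E * \int[Q]_x g x)%E.
Proof.
pose m : {measure set T -> \bar R} :=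
  measure_add (mscale (NngNum u0) P) (mscale (NngNum s0) Q).
have mE A : m A = (u%:E * P A + s%:E * Q A)%E by exact: measure_addE.
have [|M ME] := @probability_of_measure _ _ _ m.
  by rewrite mE !probability_setT !mule1 -EFinD us1.
exists M; split=> [A|g mg g0]; first by rewrite ME mE.
by rewrite ME ge0_integral_measure_add// !ge0_integral_mscale.
Qed.

Lemma prior_probability (h : nat) :
  exists P : probability (branching R h) R,
    P = prior_ h :> (set (branching R h) -> \bar R).
Proof.
elim: h => [|h [Q QE]]; first by exists (@dirac _ (branching R 0) tt R).
have [B [BE _]] := beta_pair_probability alpha0.
have [M [ME _]] := @mixture_probability _ (branching R h.+1)
  (@dirac _ (branching R h.+1) (uniform_branching R h.+1) R) (B \x (Q \x Q))%E.
by exists M; apply/funext => A; rewrite ME /= -BE -QE.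
Qed.

(** The Dirac part evaluates the integrand at the uniform branching. Under the product part,
    Tonelli's theorem is used twice: to split the root pair from the subtrees, then one subtree from
    the other. *)
Lemma integral_prior_rec (h : nat) (k : RR -> R) (L0 L1 : branching R h -> R) :
  measurable_fun setT k -> measurable_fun setT L0 -> measurable_fun setT L1 ->
  (forall x, 0 <= k x) -> (forall q, 0 <= L0 q) -> (forall q, 0 <= L1 q) ->
  (\int[prior_ h.+1]_q (k q.1 * (L0 q.2.1 * L1 q.2.2))%:E =
   u%:E * (k (2^-1, 2^-1) *
           (L0 (uniform_branching R h) * L1 (uniform_branching R h)))%:E +
   s%:E * (\int[mu]_p ((k (p, (1 - p)%R))%:E * (beta_pdf01 alpha alpha p)%:E) *
           (\int[prior_ h]_q (L0 q)%:E * \int[prior_ h]_q (L1 q)%:E)))%E.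
Proof.
move=> mk mL0 mL1 k0 L00 L10.
have [Q QE] := prior_probability h.
have [B [BE intB]] := beta_pair_probability alpha0.
have [M [ME intM]] := @mixture_probability _ (branching R h.+1)
  (@dirac _ (branching R h.+1) (uniform_branching R h.+1) R) (B \x (Q \x Q))%E.
have -> : prior_ h.+1 = M by apply/funext => A; rewrite ME /= -BE -QE.
have mL : measurable_fun [set: branching R h * branching R h]
    (fun q => L0 q.1 * L1 q.2).
  by apply: measurable_funM; [exact: measurableT_comp mL0 measurable_fst
                             |exact: measurableT_comp mL1 measurable_snd].
have mF : measurable_fun [set: branching R h.+1]
    (fun q => (k q.1 * (L0 q.2.1 * L1 q.2.2))%:E).
  apply/measurable_EFinP; apply: measurable_funM.
    exact: measurableT_comp mk measurable_fst.
  exact: measurableT_comp mL measurable_snd.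
have F0 (q : branching R h.+1) : (0 <= (k q.1 * (L0 q.2.1 * L1 q.2.2))%:E)%E.
  by rewrite lee_fin !mulr_ge0.
rewrite intM// integral_dirac// diracT mul1e -QE; congr (_ + _ * _)%E.
rewrite -(intB (fun x => (k x)%:E))//; last exact/measurable_EFinP.
pose QQ : probability (branching R h * branching R h)%type R := (Q \x Q)%E.
rewrite [LHS](@fubini_tonelli1 _ _ _ _ _ B QQ _ mF F0) /fubini_F/=.
have E : (\int[Q \x Q]_q (L0 q.1 * L1 q.2)%:E =
    \int[Q]_q (L0 q)%:E * \int[Q]_q (L1 q)%:E)%E.
  rewrite (@fubini_tonelli1 _ _ _ _ _ Q Q)//; last 2 first.
  - exact/measurable_EFinP.
  - by move=> q; rewrite lee_fin mulr_ge0.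
  rewrite /fubini_F/= -ge0_integralZr//; last 3 first.
  - exact/measurable_EFinP.
  - by move=> q _; rewrite lee_fin.
  - by apply: integral_ge0 => q _; rewrite lee_fin.
  apply: eq_integral => q _; rewrite -ge0_integralZl//.
  - exact/measurable_EFinP.
  - by move=> q' _; rewrite lee_fin.
  - by rewrite lee_fin.
rewrite -E -ge0_integralZr//; last 3 first.
- exact/measurable_EFinP.
- by move=> q _; rewrite lee_fin.
- by apply: integral_ge0 => q _; rewrite lee_fin mulr_ge0.
apply: eq_integral => q _; rewrite -ge0_integralZl//.
- exact/measurable_EFinP.
- by move=> q' _; rewrite lee_fin mulr_ge0.
- by rewrite lee_fin.
Qed.

(** A measurable set of full prior mass on which all branching probabilities are nonnegative. *)
Fixpoint unit_branching (h : nat) : set (branching R h) :=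
  match h return set (branching R h) with
  | 0 => setT
  | h'.+1 => (`[0, 1] `*` `[0, 1]) `*` (@unit_branching h' `*` @unit_branching h')
  end.

Lemma measurable_unit_branching (h : nat) : measurable (@unit_branching h).
Proof.
elim: h => [|h IH]; first exact: measurableT.
by apply: measurableX; apply: measurableX.
Qed.

Lemma uniform_branching_unit (h : nat) : @unit_branching h (uniform_branching R h).
Proof.
elim: h => [//|h IH]; split; split => //=; rewrite in_itv/= invr_ge0 ler0n/=;
by rewrite invf_le1// ler1n.
Qed.

Lemma branch_prob_ge0 (h : nat) (q : branching R h) (y : seq bool) :
  @unit_branching h q -> 0 <= branch_prob q y.
Proof.
elim: h q y => [//|h IH] q y [[q0 q1] [S0 S1]]; case: y => [//|b [|c y]] /=.
  by case: b; [move: q1|move: q0]; rewrite /= in_itv/= => /andP[].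
by case: b; exact: IH.
Qed.

Lemma prior_unit_branching (h : nat) : prior_ h (@unit_branching h) = 1%E.
Proof.
elim: h => [|h IH]; first by rewrite /= diracT.
have [Q QE] := prior_probability h.
have [B [BE _]] := beta_pair_probability alpha0.
(* For [p] in [[0, 1]] the pair [(p, 1 - p)] lies in the unit square, so the square and the whole
   plane give the same integral over [p]. *)
have B01 : B (`[0, 1] `*` `[0, 1]) = 1%E.
  have <- : B setT = 1%E by exact: probability_setT.
  rewrite !BE /beta_pair /pushforward; congr (integral _ _ _).
  apply/seteqP; split=> x /=; rewrite !in_itv/=; first by case.
  by move=> [_ /andP[x0 x1]]; rewrite x0 x1 subr_ge0 x1 gerBl x0.
have mU := measurable_unit_branching h.
rewrite /= diracE mem_set; last exact: (uniform_branching_unit h.+1).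
pose QQ : probability (branching R h * branching R h)%type R := (Q \x Q)%E.
have QQ1 : QQ (@unit_branching h `*` @unit_branching h) = 1%E.
  have Q1 : Q (@unit_branching h) = 1%E by rewrite QE.
  rewrite [LHS](@product_measure1E _ _ _ _ _ Q Q)//.
  by rewrite [X in (X * _)%E]Q1 [X in (_ * X)%E]Q1 mule1.
rewrite -BE -QE (@product_measure1E _ _ _ _ _ B QQ); [|exact: measurableX..].
rewrite [X in (_ + _ * (X * _))%E]B01 [X in (_ + _ * (_ * X))%E]QQ1 !mule1.
by rewrite -EFinD us1.
Qed.

(* Outside the support of the prior the branching probabilities may be negative;
   taking norms makes the integrand nonnegative everywhere, as Tonelli's theorem
   requires. *)
Lemma integral_prior_norm (h : nat) (f : branching R h -> R) :
  measurable_fun setT f -> (forall q, @unit_branching h q -> 0 <= f q) ->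
  (\int[prior_ h]_q (f q)%:E = \int[prior_ h]_q `|f q|%:E)%E.
Proof.
move=> mf f0; have [Q QE] := prior_probability h.
have mU := measurable_unit_branching h.
have QU : Q (@unit_branching h) = 1%E by rewrite QE; exact: prior_unit_branching.
rewrite -QE; apply: ae_eq_integral => //.
- exact/measurable_EFinP.
- by apply/measurable_EFinP; exact: measurableT_comp.
exists (~` @unit_branching h); split; first exact: measurableC.
  by rewrite [LHS](probability_setC Q mU) QU subee.
by move=> q /=; apply: contra_not => Uq _; rewrite ger0_norm// f0.
Qed.

Lemma measurable_branch_prob (h : nat) (y : seq bool) :
  measurable_fun [set: branching R h] (fun q => branch_prob q y).
Proof.
elim: h y => [|h IH] [|b [|c y]] /=; try exact: measurable_cst.
  by case: b; apply: measurableT_comp measurable_fst;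
    [exact: measurable_snd|exact: measurable_fst].
case: b; apply: (measurableT_comp (IH (c :: y)));
  by [exact: measurableT_comp measurable_snd measurable_snd
     |exact: measurableT_comp measurable_fst measurable_snd].
Qed.

(** The bounds on [size y] exclude the strings on which [branch_prob] takes its junk value 0. *)
Lemma branch_prob_uniform (h : nat) (y : seq bool) : (0 < size y <= h)%N ->
  branch_prob (uniform_branching R h) y = 2^-1.
Proof.
elim: h y => [|h IH] [|b [|c y]]//=; first by case: b.
by rewrite ltnS => yh; case: b; exact: IH.
Qed.

End prior.

(** * Cells and likelihoods *)

Section cells.
Context (R : realType) d (X : measurableType d) (vol : {measure set X -> \bar R}).
Variables (G : set X) (m : nat) (Gam : seq bool -> set X).
Hypothesis hGam : tree_partition vol G m Gam.

Lemma cell_rcons (z : seq bool) (b : bool) (x : X) :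
  (size z < m)%N -> Gam (rcons z b) x -> Gam z x.
Proof.
by move=> zm Gx; rewrite (tree_partition_union hGam zm); case: b Gx; [right|left].
Qed.

Lemma cell_rcons_inj (z : seq bool) (b c : bool) (x : X) :
  (size z < m)%N -> Gam (rcons z b) x -> Gam (rcons z c) x -> b = c.
Proof.
move=> zm; have /seteqP[D _] := tree_partition_disjoint hGam zm.
by case: b; case: c => // Gb Gc; case: (D x).
Qed.

(** Induction on the last bit: the parent cells also contain [x], hence coincide, and sibling cells
    are disjoint. *)
Lemma cell_uniq (y z : seq bool) (x : X) : size y = size z -> (size y <= m)%N ->
  Gam y x -> Gam z x -> y = z.
Proof.
elim/last_ind: y z => [|y b IH] z; first by move/esym/size0nil ->.
case/lastP: z => [|z c]; rewrite !size_rcons// => -[yz] ym Gy Gz.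
have zm : (size z < m)%N by rewrite -yz.
have E := IH _ yz (ltnW ym) (cell_rcons ym Gy) (cell_rcons zm Gz).
by move: Gz; rewrite -E => Gz; rewrite (cell_rcons_inj ym Gy Gz).
Qed.

Lemma cell_extend (z : seq bool) (x : X) (i : nat) :
  Gam z x -> (size z + i <= m)%N -> exists2 t, size t = i & Gam (z ++ t) x.
Proof.
move=> Gz; elim: i => [|i IH] zim; first by exists [::]; rewrite ?cats0.
rewrite addnS in zim; have [t ti Gt] := IH (ltnW zim).
have ztm : (size (z ++ t) < m)%N by rewrite size_cat ti.
move: Gt; rewrite (tree_partition_union hGam ztm) !rcons_cat => -[] Gt;
  by [exists (rcons t false) => //; rewrite size_rcons ti
     |exists (rcons t true) => //; rewrite size_rcons ti].
Qed.

(** Descending from [z] yields a cell of depth [i] containing [x], so [xget] does not fall back on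
    its default, and uniqueness identifies its choice. Dropping [size z] bits then leaves the
    address [t] relative to [z]. *)
Lemma drop_cell_addr (z : seq bool) (x : X) (i : nat) :
  Gam z x -> (size z <= i <= m)%N ->
  exists2 t, size t = (i - size z)%N & cell_addr Gam x i = z ++ t.
Proof.
move=> Gz /andP[zi im].
have [|t ti Gt] := @cell_extend z x (i - size z) Gz; first by rewrite subnKC.
exists t => //.
have zti : size (z ++ t) = i by rewrite size_cat ti subnKC.
rewrite /cell_addr; case: xgetP => [y _ [yi Gy]|/(_ (z ++ t)) []//].
by apply: (cell_uniq _ _ Gy Gt); rewrite yi// zti.
Qed.

Lemma mem_cell_children (z : seq bool) (x : X) : (size z < m)%N ->
  (x \in Gam z) = (x \in Gam (rcons z false)) || (x \in Gam (rcons z true)).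
Proof. by move=> zm; rewrite (tree_partition_union hGam zm) in_setU. Qed.

Lemma mem_cell_disjoint (z : seq bool) (x : X) : (size z < m)%N ->
  ~~ ((x \in Gam (rcons z false)) && (x \in Gam (rcons z true))).
Proof.
move=> zm; apply/negP => /andP[]; rewrite !in_setE => x0 x1.
by have := cell_rcons_inj zm x0 x1.
Qed.

Lemma size_cell_data (D : seq X) (z : seq bool) : (size z < m)%N ->
  size (cell_data Gam D z) =
  (size (cell_data Gam D (rcons z false)) +
   size (cell_data Gam D (rcons z true)))%N.
Proof.
move=> zm; rewrite /cell_data !size_filter.
elim: D => //= x D ->; rewrite mem_cell_children//.
have := mem_cell_disjoint x zm.
by case: (_ \in _); case: (_ \in _) => //= _; rewrite ?add0n ?add1n ?addnS.
Qed.

Lemma prod_cell_data (F : X -> R) (D : seq X) (z : seq bool) : (size z < m)%N ->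
  \prod_(x <- cell_data Gam D z) F x =
  \prod_(x <- cell_data Gam D (rcons z false)) F x *
  \prod_(x <- cell_data Gam D (rcons z true)) F x.
Proof.
move=> zm; rewrite /cell_data !big_filter.
elim: D => [|x D IH]; first by rewrite !big_nil mulr1.
rewrite !big_cons IH mem_cell_children//.
have := mem_cell_disjoint x zm.
by case: (_ \in _); case: (_ \in _) => //= _; ring.
Qed.

(* [likelihood] with the height h freed from [m - size z], so that no cast is
   needed between [m - size z] and the successor of [m - (size z).+1]. *)
Definition height_likelihood (h l : nat) (q : branching R h) (D : seq X) : R :=
  \prod_(x <- D) \prod_(l.+1 <= i < m.+1)
    (2 * branch_prob q (drop l (cell_addr Gam x i))).

Lemma measurable_height_likelihood (h l : nat) (D : seq X) :
  measurable_fun [set: branching R h] (fun q => height_likelihood l q D).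
Proof.
apply: measurable_prod => x _; apply: measurable_prod => i _.
by apply: measurable_funM; [exact: measurable_cst|exact: measurable_branch_prob].
Qed.

Lemma height_likelihood_ge0 (h l : nat) (q : branching R h) (D : seq X) :
  unit_branching q -> 0 <= height_likelihood l q D.
Proof.
move=> Uq; apply: prodr_ge0 => x _; apply: prodr_ge0 => i _.
by rewrite mulr_ge0// branch_prob_ge0.
Qed.

(** Each relative address has length between 1 and [h], so every factor is twice one half. *)
Lemma height_likelihood_uniform (h : nat) (z : seq bool) (D : seq X) :
  (size z + h)%N = m ->
  height_likelihood (size z) (uniform_branching R h) (cell_data Gam D z) = 1.
Proof.
move=> zh; rewrite /height_likelihood /cell_data big_filter; apply: big1 => x.
rewrite in_setE => Gx; rewrite big_nat; apply: big1 => i /andP[zi im].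
have [|t ti ->] := @drop_cell_addr z x i Gx; first by rewrite ltnW.
rewrite drop_size_cat// branch_prob_uniform ?mulfV// ti subn_gt0 zi.
by rewrite leq_subLR zh.
Qed.

(** All points of the child cell share the first step [b], which contributes the power; their later
    factors only read the subtree on the side of [b]. *)
Lemma height_likelihood_child (h : nat) (z : seq bool) (b : bool)
    (q : branching R h.+1) (D : seq X) : (size z < m)%N ->
  height_likelihood (size z) q (cell_data Gam D (rcons z b)) =
  (2 * (if b then q.1.2 else q.1.1)) ^+ size (cell_data Gam D (rcons z b)) *
  height_likelihood (size z).+1 (if b then q.2.2 else q.2.1)
    (cell_data Gam D (rcons z b)).
Proof.
move=> zm; set D' := cell_data _ _ _.
(* The power becomes a constant product over the data, so that the claim can be checked point by
   point. *)
rewrite -iter_mulr_1 -(count_predT D') -big_const_seq -big_split/=.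
rewrite /height_likelihood /D' /cell_data !big_filter; apply: eq_bigr => x.
rewrite in_setE => Gx; rewrite big_ltn//; congr (_ * _).
  have [|t ti ->] := @drop_cell_addr _ x (size z).+1 Gx.
    by rewrite size_rcons leqnn.
  move: ti; rewrite size_rcons subnn => /size0nil ->.
  by rewrite cats0 -cats1 drop_size_cat.
apply: eq_big_nat => i /andP[zi im].
have [|t ti ->] := @drop_cell_addr _ x i Gx; first by rewrite size_rcons ltnW.
move: ti; rewrite -cats1 -catA drop_size_cat// /= size_cat addn1 => ti.
rewrite -cat_rcons drop_size_cat ?size_rcons//.
(* Since [i] exceeds [(size z).+1], the string after [b] is nonempty, and [branch_prob] recurses
   into the subtree instead of returning the root probability. *)
by case: t ti => [ti|c t _]; [move: zi; rewrite -subn_gt0 -ti|case: (b)].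
Qed.

End cells.

(** * The recursion for the evidence *)

Lemma weight_gt0 (R : realType) (a : R) (i j : nat) : 0 < a -> 0 < weight a i j.
Proof.
move=> a0; have G0 k : 0 < Gamma_fun (k%:R + a) by rewrite Gamma_fun_gt0// ltr_wpDl.
have a20 : 0 < 2 * a by rewrite mulr_gt0.
by rewrite /weight !mulr_gt0 ?invr_gt0 ?exprn_gt0 ?mulr_gt0 ?Gamma_fun_gt0 ?ltr_wpDl.
Qed.

Theorem theorem1 (R : realType) (d : measure_display) (X : measurableType d)
    (vol : {measure set X -> \bar R}) (G : set X) (m : nat)
    (Gam : seq bool -> set X) (hGam : tree_partition vol G m Gam)
    (alpha u s : R) (halpha : 0 < alpha)
    (hu : 0 <= u <= 1) (hs : 0 <= s <= 1) (hus : u + s = 1)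
    (D : seq X) (hD : forall x, x \in D -> G x)
    (z : seq bool) (hz : (size z <= m)%N) :
  ((size z < m)%N ->
    size (cell_data Gam D z) =
      (size (cell_data Gam D (rcons z false)) +
       size (cell_data Gam D (rcons z true)))%N /\
    evidence Gam alpha u s m z (cell_data Gam D z) =
    (u%:E +
     s%:E *
      (evidence Gam alpha u s m (rcons z false) (cell_data Gam D (rcons z false))
       * evidence Gam alpha u s m (rcons z true) (cell_data Gam D (rcons z true))
       / (weight alpha (size (cell_data Gam D (rcons z false)))
                       (size (cell_data Gam D (rcons z true))))%:E))%E) /\
  (size z = m ->
    evidence Gam alpha u s m z (cell_data Gam D z) = 1%E).
Proof.
have /andP[u0 _] := hu; have /andP[s0 _] := hs.
have evE y D' : evidence Gam alpha u s m y D' =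
  (\int[prior_height alpha u s (h := m - size y)]_q
     (height_likelihood m Gam (size y) q D')%:E)%E by [].
split=> [zm|zm]; last first.
  (* At a leaf the product over [i] is empty, so the constant 1 is integrated against a
     probability. *)
  rewrite evE zm subnn; have [Q <-] := prior_probability halpha u0 s0 hus 0.
  rewrite (eq_integral (cst 1%E)) => [|q _].
    by rewrite integral_cst// mul1e; exact: probability_setT.
  rewrite /height_likelihood; congr (_%:E); apply: big1 => x _.
  by rewrite big_geq.
split; first exact: size_cell_data hGam _ _ zm.
rewrite !evE !size_rcons.
set D0 := cell_data Gam D (rcons z false).
set D1 := cell_data Gam D (rcons z true).
set l := size z; set h := (m - l.+1)%N.
(* The height is now a free index, so this rewriting exposes the successor case of the prior without
   a cast. *)
have -> : (m - l)%N = h.+1 by rewrite subnSK.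
pose k (x : R * R) := `|2 * x.1| ^+ size D0 * `|2 * x.2| ^+ size D1.
pose L D' (q : branching R h) := height_likelihood m Gam l.+1 q D'.
have LE (q : branching R h.+1) :
    `|height_likelihood m Gam l q (cell_data Gam D z)| =
    k q.1 * (`|L D0 q.2.1| * `|L D1 q.2.2|).
  rewrite /height_likelihood (prod_cell_data hGam _ _ zm).
  rewrite -!/(height_likelihood m Gam l q _) !(height_likelihood_child hGam)//.
  by rewrite !normrM !normrX mulrACA.
have mL D' : measurable_fun [set: branching R h] (fun q => `|L D' q|).
  by apply: measurableT_comp => //; exact: measurable_height_likelihood.
have mk : measurable_fun [set: measurableTypeR R * measurableTypeR R] k.
  by apply: measurable_funM; apply: measurable_funX; apply: measurableT_comp => //;
    apply: measurable_funM.
(* Norms are inserted in all three evidences, so that the factorization [LE] fits the nonnegativity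
   conditions of [integral_prior_rec]. *)
have normE h' l' D' : (\int[prior_height alpha u s (h := h')]_q
      (height_likelihood m Gam l' q D')%:E =
    \int[prior_height alpha u s (h := h')]_q
      `|height_likelihood m Gam l' q D'|%:E)%E.
  apply: integral_prior_norm => //; first exact: measurable_height_likelihood.
  by move=> q; exact: height_likelihood_ge0.
rewrite (normE h.+1 l) (normE h l.+1 D0) (normE h l.+1 D1).
have -> : (fun q => `|height_likelihood m Gam l q (cell_data Gam D z)|%:E) =
    (fun q : branching R h.+1 => (k q.1 * (`|L D0 q.2.1| * `|L D1 q.2.2|))%:E).
  by apply/funext => q; rewrite LE.
have k0 x : 0 <= k x by rewrite mulr_ge0 ?exprn_ge0.
rewrite (integral_prior_rec halpha u0 s0 hus mk (mL D0) (mL D1))//.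
(* At the uniform branching the likelihood is 1, so the factored integrand in the term of [u] is 1
   as well. *)
have := LE (uniform_branching R h.+1).
rewrite (height_likelihood_uniform hGam) ?subnSK ?subnKC//= normr1 => <-.
(* The extended-real inverse agrees with the real one only at a nonzero weight, hence the appeal to
   [weight_gt0]. *)
rewrite mule1 (integral_beta_moment _ _ halpha) inver.
by rewrite gt_eqF ?weight_gt0//; congr (_ + _ * _)%E; exact: muleC.
Qed.
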